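(* Let $n\ge 4$, let $P$ be an $n\times n$ pentadiagonal matrix over $K$ ($K=\mathbb{R}$ or $\mathbb{C}$) with entries $P_{i,i}=d_i$, $P_{i,i+1}=a_i$, $P_{i,i+2}=b_i$, $P_{i,i-1}=c_i$, $P_{i,i-2}=e_i$ and all other entries $0$, and let $Y=(y_1,\dots,y_n)^t\in K^n$. If the quantities $\psi_1,\dots,\psi_n$ computed by the algorithm PTRANS-II (described in the context) satisfy $\psi_i\neq 0$ for all $i=1,\dots,n$, then PTRANS-II applied to $(P,Y)$ is valid: the vector $X=(x_1,\dots,x_n)^t$ it outputs is the unique solution of $PX=Y$. Moreover, its computational cost (excluding the preliminary determinant check) is $19n-29$ arithmetic operations.
   Context: The algorithm PTRANS-II, on input $n\ge 4$, the entries of $P$, and $Y$, does the following. (0) Check whether $\det(P)=0$; if so, exit. (1) Set $\psi_n=d_n$, $\sigma_n=\frac{c_n}{\psi_n}$, $\phi_n=\frac{e_n}{\psi_n}$, $w_n=\frac{y_n}{\psi_n}$. (2) Set $\rho_{n-1}=a_{n-1}$, $\psi_{n-1}=d_{n-1}-\sigma_n\rho_{n-1}$, $\sigma_{n-1}=\frac{c_{n-1}-\phi_n\rho_{n-1}}{\psi_{n-1}}$, $\phi_{n-1}=\frac{e_{n-1}}{\psi_{n-1}}$, $w_{n-1}=\frac{y_{n-1}-w_n\rho_{n-1}}{\psi_{n-1}}$. (3) For $i=n-2,n-3,\dots,3$ in decreasing order (no iterations if $n=4$) compute $\rho_i=a_i-\sigma_{i+2}b_i$, $\psi_i=d_i-\phi_{i+2}b_i-\sigma_{i+1}\rho_i$,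 $\sigma_i=\frac{c_i-\phi_{i+1}\rho_i}{\psi_i}$, $\phi_i=\frac{e_i}{\psi_i}$, $w_i=\frac{y_i-w_{i+2}b_i-w_{i+1}\rho_i}{\psi_i}$. (4) Compute $\rho_2=a_2-\sigma_4b_2$, $\psi_2=d_2-\phi_4b_2-\sigma_3\rho_2$, $\sigma_2=\frac{c_2-\phi_3\rho_2}{\psi_2}$, $\rho_1=a_1-\sigma_3b_1$, $\psi_1=d_1-\phi_3b_1-\sigma_2\rho_1$, $w_2=\frac{y_2-w_4b_2-w_3\rho_2}{\psi_2}$, $w_1=\frac{y_1-w_3b_1-w_2\rho_1}{\psi_1}$. (5) Set $x_1=w_1$, $x_2=w_2-\sigma_2x_1$, and for $i=3,4,\dots,n$ set $x_i=w_i-\sigma_ix_{i-1}-\phi_ix_{i-2}$. Output $X=(x_1,\dots,x_n)^t$. The condition ''$\psi_i\ne0$ for all $i$'' means that, computing in order, each $\psi_i$ is nonzero (so every division is defined). The computational cost is the number of additions, subtractions, multiplications and divisions performed when the formulas of steps (1)–(5) are evaluated exactly as written. *)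

(* Defs.v *)
From HB Require Import structures.
From mathcomp Require Import all_boot all_order all_algebra.
From mathcomp Require Export reals complex.

Set Implicit Arguments.
Unset Strict Implicit.
Unset Printing Implicit Defensive.

Import GRing.Theory.
Local Open Scope ring_scope.

(* All sequences a, b, c, d, e, y are 1-based, as in the matrix below; the     *)
(* values a_n, b_(n-1), b_n, c_1, e_1, e_2 occur neither in the matrix nor in  *)
(* the algorithm. *)
Definition pentadiag (K : fieldType) (n : nat) (a b c d e : nat -> K) :
    'M[K]_n :=
  \matrix_(i < n, j < n)
    if j == i :> nat then d i.+1
    else if j == i.+1 :> nat then a i.+1
    else if j == i.+2 :> nat then b i.+1
    else if i == j.+1 :> nat then c i.+1
    else if i == j.+2 :> nat then e i.+1
    else 0.

Variant reg := Rho | Psi | Sigma | Phi | W | X.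

Definition eqreg (r s : reg) : bool :=
  match r, s with
  | Rho, Rho | Psi, Psi | Sigma, Sigma | Phi, Phi | W, W | X, X => true
  | _, _ => false
  end.

Inductive expr (K : Type) : Type :=
  | Const of K
  | Cell of reg & nat
  | Add of expr K & expr K
  | Sub of expr K & expr K
  | Mul of expr K & expr K
  | Div of expr K & expr K.

Arguments Cell {K} _ _.

Fixpoint ops (K : Type) (t : expr K) : nat :=
  match t with
  | Const _ | Cell _ _ => 0
  | Add t1 t2 | Sub t1 t2 | Mul t1 t2 | Div t1 t2 => (ops t1 + ops t2).+1
  end.

(* [None] is the content of a cell that has not been assigned, or whose        *)
(* assigned formula is undefined. *)
Definition store (K : Type) := reg -> nat -> option K.

(* Division by zero is undefined here, unlike the total division of K. *)
Fixpoint eval (K : fieldType) (s : store K) (t : expr K) : option K :=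
  let lift (op : K -> K -> option K) u v :=
    if u is Some x then if v is Some y then op x y else None else None in
  match t with
  | Const x => Some x
  | Cell r i => s r i
  | Add t1 t2 => lift (fun x y => Some (x + y)) (eval s t1) (eval s t2)
  | Sub t1 t2 => lift (fun x y => Some (x - y)) (eval s t1) (eval s t2)
  | Mul t1 t2 => lift (fun x y => Some (x * y)) (eval s t1) (eval s t2)
  | Div t1 t2 =>
      lift (fun x y => if y == 0 then None else Some (x / y))
        (eval s t1) (eval s t2)
  end.

Record instr (K : Type) := Assign {
  target : reg; index : nat; formula : expr K }.

(* The second component of the state counts the arithmetic operations          *)
(* performed so far. *)
Definition exec (K : fieldType) (st : store K * nat) (p : instr K) :
    store K * nat :=
  let: (s, t) := st in
  let v := eval s (formula p) in
  (fun r i => if eqreg r (target p) && (i == index p) then v else s r i,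
   (t + ops (formula p))%N).

Definition run (K : fieldType) (prog : seq (instr K)) : store K * nat :=
  foldl (@exec K) (fun _ _ => None, 0%N) prog.

Declare Scope ptrans_scope.
Delimit Scope ptrans_scope with P.
Bind Scope ptrans_scope with expr.
Notation "s - t" := (Sub s t) : ptrans_scope.
Notation "s * t" := (Mul s t) : ptrans_scope.
Notation "s / t" := (Div s t) : ptrans_scope.
Notation "r `_ i" := (Cell r i) : ptrans_scope.
Notation "[ 'in' x ]" := (Const x) (format "[ 'in'  x ]") : ptrans_scope.
Notation "r # i <~ t" := (Assign r i t%P)
  (at level 70, i at level 8, t at level 69, no associativity).

Definition ptransII_prog (K : fieldType) (n : nat)
    (a b c d e y : nat -> K) : seq (instr K) :=
  [:: Psi # n <~ [in d n];
      Sigma # n <~ [in c n] / Psi`_n;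
      Phi # n <~ [in e n] / Psi`_n;
      W # n <~ [in y n] / Psi`_n ] ++
  (let m := n.-1 in
   [:: Rho # m <~ [in a m];
       Psi # m <~ [in d m] - Sigma`_n * Rho`_m;
       Sigma # m <~ ([in c m] - Phi`_n * Rho`_m) / Psi`_m;
       Phi # m <~ [in e m] / Psi`_m;
       W # m <~ ([in y m] - W`_n * Rho`_m) / Psi`_m ]) ++
  flatten
    [seq
      [:: Rho # i <~ [in a i] - Sigma`_(i.+2) * [in b i];
          Psi # i <~ [in d i] - Phi`_(i.+2) * [in b i] - Sigma`_(i.+1) * Rho`_i;
          Sigma # i <~ ([in c i] - Phi`_(i.+1) * Rho`_i) / Psi`_i;
          Phi # i <~ [in e i] / Psi`_i;
          W # i <~ ([in y i] - W`_(i.+2) * [in b i] - W`_(i.+1) * Rho`_i)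
                   / Psi`_i ]
    | i <- rev (iota 3 (n - 4))] ++
  [:: Rho # 2 <~ [in a 2] - Sigma`_4 * [in b 2];
      Psi # 2 <~ [in d 2] - Phi`_4 * [in b 2] - Sigma`_3 * Rho`_2;
      Sigma # 2 <~ ([in c 2] - Phi`_3 * Rho`_2) / Psi`_2;
      Rho # 1 <~ [in a 1] - Sigma`_3 * [in b 1];
      Psi # 1 <~ [in d 1] - Phi`_3 * [in b 1] - Sigma`_2 * Rho`_1;
      W # 2 <~ ([in y 2] - W`_4 * [in b 2] - W`_3 * Rho`_2) / Psi`_2;
      W # 1 <~ ([in y 1] - W`_3 * [in b 1] - W`_2 * Rho`_1) / Psi`_1 ] ++
  [:: X # 1 <~ W`_1;
      X # 2 <~ W`_2 - Sigma`_2 * X`_1 ] ++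
  [seq X # i <~ W`_i - Sigma`_i * X`_(i.-1) - Phi`_i * X`_(i.-2)
  | i <- iota 3 (n - 2)].

Definition ptransII_psi (K : fieldType) (n : nat)
    (a b c d e y : nat -> K) : nat -> option K :=
  (run (ptransII_prog n a b c d e y)).1 Psi.

(* [None] when the determinant check exits or some x_i is undefined. *)
Definition ptransII (K : fieldType) (n : nat)
    (a b c d e y : nat -> K) : option 'cV[K]_n :=
  if \det (pentadiag n a b c d e) == 0 then None
  else
    let x := (run (ptransII_prog n a b c d e y)).1 X in
    if [forall i : 'I_n, x i.+1 != None]
    then Some (\col_(i < n) odflt 0 (x i.+1))
    else None.

(* The determinant check is not counted. *)
Definition ptransII_cost (K : fieldType) (n : nat)
    (a b c d e y : nat -> K) : nat :=
  (run (ptransII_prog n a b c d e y)).2.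

(* Main.v *)
Require Import Defs.
From mathcomp Require Import all_boot all_order all_algebra.
From mathcomp Require Import zify ring.

Set Implicit Arguments.
Unset Strict Implicit.
Unset Printing Implicit Defensive.

Import GRing.Theory.

Local Open Scope ring_scope.

(* The elimination factors the pentadiagonal matrix as U L, where row i of U is *)
(* (psi_i, rho_i, b_i) starting on the diagonal and row i of L is               *)
(* (phi_i, sigma_i, 1) ending on the diagonal, and w solves U w = Y. Hence      *)
(* P X - Y = U z for the residual z = L X - w, so PX = Y is equivalent to       *)
(* z = 0, i.e. to the recurrence of step (5), as soon as no psi_i vanishes.     *)
(* That the stored values satisfy the equations of steps (1)-(5) holds because  *)
(* every cell is assigned once, after all the cells that its formula reads.     *)

(** With [x 0 = 0] and with [x], [sg], [ph], [w] zero past [n], the identity P X - Y = U (L X - w)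
    takes the same form in every row: this is [elimination_row]. As U is upper triangular with
    diagonal psi, [elimination_equiv] turns PX = Y into L X = w, and L is unit lower triangular, so
    exactly one X satisfies it. Uniqueness makes P nonsingular, hence the determinant check passes.
    [foldl_exec_satisfies] replaces the execution by equations in the final store, and
    [ptransII_elimination] brings them into the form above. The cost does not depend on the data,
    since no instruction branches: steps (1) to (5) contribute 3, 9, 15(n-4), 25 and 2 + 4(n-2). *)

Fixpoint reads_below (K : Type) (rk : reg -> nat -> nat) (m : nat)
    (t : expr K) : bool :=
  match t with
  | Const _ => true
  | Cell r i => (rk r i < m)%N
  | Add t1 t2 | Defs.Sub t1 t2 | Mul t1 t2 | Div t1 t2 =>
      reads_below rk m t1 && reads_below rk m t2
  end.

(* Single assignment in rank order: no cell is overwritten once read. *)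
Fixpoint ranked (K : Type) (rk : reg -> nat -> nat) (lo : nat)
    (prog : seq (instr K)) (hi : nat) : bool :=
  if prog is p :: q then
    let m := rk (target p) (Defs.index p) in
    [&& lo <= m, reads_below rk m (formula p) & ranked rk m.+1 q hi]%N
  else (lo <= hi)%N.

(** The equations are between options: an undefined formula gives [None] on both sides, so
    definedness is a separate question. *)
Fixpoint satisfies (K : fieldType) (s : store K) (prog : seq (instr K)) :
    Prop :=
  if prog is p :: q then
    s (target p) (Defs.index p) = eval s (formula p) /\ satisfies s q
  else True.

Lemma eqregP (r s : reg) : reflect (r = s) (eqreg r s).
Proof. by case: r; case: s; constructor. Qed.

Lemma eval_eq_below (K : fieldType) (rk : reg -> nat -> nat) (m : nat)
    (s s' : store K) (t : expr K) :
  (forall r i, (rk r i < m)%N -> s r i = s' r i) ->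
  reads_below rk m t -> eval s t = eval s' t.
Proof.
move=> ss'; by elim: t => //= [|||] t1 IH1 t2 IH2 /andP[/IH1-> /IH2->].
Qed.

Lemma foldl_exec_below (K : fieldType) (rk : reg -> nat -> nat) (lo hi : nat)
    (prog : seq (instr K)) (st : store K * nat) :
  ranked rk lo prog hi ->
  forall r i, (rk r i < lo)%N -> (foldl (@exec K) st prog).1 r i = st.1 r i.
Proof.
elim: prog lo st => //= p q IH lo [s t] /and3P[lop _ /IH hq] r i rlo.
rewrite hq ?ltnS /=; last by lia.
case: eqregP => //= hr; case: eqP => //= hi'; move: rlo lop; rewrite hr hi'; lia.
Qed.

(** An instruction reads only cells of rank below that of its target. Neither it nor a later
    instruction overwrites those, and no later one overwrites the target, so its formula has the
    same value in the final store as when it was executed. *)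
Lemma foldl_exec_satisfies (K : fieldType) (rk : reg -> nat -> nat)
    (lo hi : nat) (prog : seq (instr K)) (st : store K * nat) :
  ranked rk lo prog hi -> satisfies (foldl (@exec K) st prog).1 prog.
Proof.
elim: prog lo st => //= p q IH lo [s t] /and3P[lop rp hq].
split; last exact: IH hq.
have below := foldl_exec_below _ hq.
rewrite below //= (introT (eqregP _ _) erefl) eqxx /=.
apply: eval_eq_below rp => r i ri; rewrite below; last exact: ltnW.
rewrite /=.
by case: eqregP => //= hr; case: eqP => //= hi'; move: ri; rewrite hr hi' ltnn.
Qed.

Lemma foldl_exec_cost (K : fieldType) (prog : seq (instr K))
    (st : store K * nat) :
  (foldl (@exec K) st prog).2 =
  (st.2 + sumn [seq ops (formula p) | p <- prog])%N.
Proof.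
by elim: prog st => [|p q IH] [s t] /=; rewrite ?addn0 // IH addnA.
Qed.

Lemma ranked_cat (K : Type) (rk : reg -> nat -> nat) (lo mid hi : nat)
    (q1 q2 : seq (instr K)) :
  ranked rk lo q1 mid -> ranked rk mid q2 hi -> ranked rk lo (q1 ++ q2) hi.
Proof.
elim: q1 lo => [|p q IH] lo /=; last first.
  by move=> /and3P[-> -> h] h2; rewrite IH.
case: q2 => [|p q] /=; first exact: leq_trans.
by move=> lom /and3P[/(leq_trans lom)-> -> ->].
Qed.

Lemma satisfies_cat (K : fieldType) (s : store K) (q1 q2 : seq (instr K)) :
  satisfies s (q1 ++ q2) <-> satisfies s q1 /\ satisfies s q2.
Proof. elim: q1 => [|p q IH] /=; first tauto. rewrite IH; tauto. Qed.

Lemma satisfies_flatten (K : fieldType) (I : eqType) (s : store K)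
    (g : I -> seq (instr K)) (l : seq I) :
  satisfies s (flatten [seq g i | i <- l]) ->
  forall i, i \in l -> satisfies s (g i).
Proof.
elim: l => //= j l IH /satisfies_cat[hj /IH hl] i.
by rewrite inE => /predU1P[->|/hl].
Qed.

Lemma satisfies_map (K : fieldType) (I : eqType) (s : store K)
    (g : I -> instr K) (l : seq I) :
  satisfies s [seq g i | i <- l] ->
  forall i, i \in l -> s (target (g i)) (Defs.index (g i)) = eval s (formula (g i)).
Proof.
elim: l => //= j l IH [hj /IH hl] i.
by rewrite inE => /predU1P[->|/hl].
Qed.

(** The blocks run in decreasing order, so block [i] starts at [h i.+1], where block [i.+1]
    ended. *)
Lemma ranked_flatten_rev (K : Type) (rk : reg -> nat -> nat)
    (g : nat -> seq (instr K)) (h : nat -> nat) (m k : nat) :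
  (forall i, (m <= i < m + k)%N -> ranked rk (h i.+1) (g i) (h i)) ->
  ranked rk (h (m + k)%N) (flatten [seq g i | i <- rev (iota m k)]) (h m).
Proof.
elim: k => [|k IH] hg; first by rewrite addn0 /=.
rewrite -addn1 iotaD rev_cat /= addn1 addnS.
apply: ranked_cat; first by apply: hg; lia.
by apply: IH => i hi; apply: hg; lia.
Qed.

Lemma ranked_map_iota (K : Type) (rk : reg -> nat -> nat)
    (g : nat -> instr K) (h : nat -> nat) (m k : nat) :
  (forall i, (m <= i < m + k)%N -> ranked rk (h i) [:: g i] (h i.+1)) ->
  ranked rk (h m) [seq g i | i <- iota m k] (h (m + k)%N).
Proof.
elim: k => [|k IH] hg; first by rewrite addn0 /=.
rewrite -addn1 iotaD map_cat addn1 addnS.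
apply: ranked_cat; last by apply: hg; lia.
by apply: IH => i hi; apply: hg; lia.
Qed.

Lemma sumn_map_flatten_const (S T : Type) (f : T -> nat) (g : S -> seq T)
    (k : nat) (l : seq S) :
  (forall i, sumn [seq f p | p <- g i] = k) ->
  sumn [seq f p | p <- flatten [seq g i | i <- l]] = (k * size l)%N.
Proof.
move=> hg; elim: l => [|i l IH] /=; first by rewrite muln0.
by rewrite map_cat sumn_cat hg IH mulnS.
Qed.

(** * Ranking and cost of PTRANS-II *)

(* Step (4) delays w_2 until after psi_1, whence the correction term. *)
Definition ptransII_rank (n : nat) (r : reg) (i : nat) : nat :=
  match r with
  | Rho => 5 * (n - i)
  | Psi => 5 * (n - i) + 1
  | Sigma => 5 * (n - i) + 2
  | Phi => 5 * (n - i) + 3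
  | W => 5 * (n - i) + 4 + 3 * (i == 2)
  | X => 5 * n + i
  end.

Lemma ptransII_ranked (K : fieldType) (n : nat) (a b c d e y : nat -> K) :
  (4 <= n)%N ->
  ranked (ptransII_rank n) 0 (ptransII_prog n a b c d e y) (6 * n).+1.
Proof.
move=> hn; rewrite /ptransII_prog.
apply: (@ranked_cat _ _ _ 5); first by rewrite /=; lia.
apply: (@ranked_cat _ _ _ 10); first by rewrite /=; lia.
apply: (@ranked_cat _ _ _ (5 * (n - 2))).
  (* Row [i] occupies five ranks from 5(n-i) on, which is [h i.+1] for this [h]. *)
  have := @ranked_flatten_rev K (ptransII_rank n) _
    (fun i => 5 * (n.+1 - i))%N 3 (n - 4).
  have -> : (5 * (n.+1 - (3 + (n - 4))) = 10)%N by lia.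
  have -> : (5 * (n.+1 - 3) = 5 * (n - 2))%N by lia.
  by apply=> i hi /=; lia.
apply: (@ranked_cat _ _ _ (5 * n).+1); first by rewrite /=; lia.
apply: (@ranked_cat _ _ _ (5 * n + 3)); first by rewrite /=; lia.
have := @ranked_map_iota K (ptransII_rank n) _ (fun i => 5 * n + i)%N 3 (n - 2).
have -> : (5 * n + (3 + (n - 2)) = (6 * n).+1)%N by lia.
by apply=> i hi /=; lia.
Qed.

Lemma ptransII_cost_eq (K : fieldType) (n : nat) (a b c d e y : nat -> K) :
  (4 <= n)%N -> ptransII_cost n a b c d e y = (19 * n - 29)%N.
Proof.
move=> hn; rewrite /ptransII_cost /run foldl_exec_cost /ptransII_prog.
rewrite !map_cat !sumn_cat (@sumn_map_flatten_const _ _ _ _ 15) //.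
(* Step (5) is seen as one-instruction blocks, so that the count used for the loop applies again. *)
rewrite size_rev size_iota -(flatten_seq1 (map _ (iota _ _))) -map_comp.
rewrite (@sumn_map_flatten_const _ _ _ _ 4) // size_iota /=; lia.
Qed.

(** * The factorization P = U L *)

(* [rho_i] is inlined as [a i - sg i.+2 * b i]; extending the sequences by      *)
(* zero beyond [n] makes the formulas of step (3) cover steps (1), (2) and (4). *)
(* At the lower end, [sg 1], [ph 1] and [ph 2] are unconstrained. *)
Record elimination (K : fieldType) (n : nat)
    (a b c d e y psi sg ph w : nat -> K) : Prop := Elimination {
  elim_psi0 : forall i, (0 < i <= n)%N -> psi i != 0;
  elim_out : forall i, (n < i)%N -> [/\ sg i = 0, ph i = 0 & w i = 0];
  elim_psi : forall i, (0 < i <= n)%N ->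
    psi i = d i - ph i.+2 * b i - sg i.+1 * (a i - sg i.+2 * b i);
  elim_sg : forall i, (1 < i <= n)%N ->
    psi i * sg i = c i - ph i.+1 * (a i - sg i.+2 * b i);
  elim_ph : forall i, (2 < i <= n)%N -> psi i * ph i = e i;
  elim_w : forall i, (0 < i <= n)%N ->
    psi i * w i = y i - w i.+2 * b i - w i.+1 * (a i - sg i.+2 * b i) }.

Lemma elimination_row (K : fieldType) (n : nat)
    (a b c d e y psi sg ph w x : nat -> K) (i : nat) :
  elimination n a b c d e y psi sg ph w -> x 0%N = 0 -> (0 < i <= n)%N ->
  let z j := x j + sg j * x j.-1 + ph j * x j.-2 - w j in
  e i * x i.-2 + c i * x i.-1 + d i * x i + a i * x i.+1 + b i * x i.+2 - y i =
  psi i * z i + (a i - sg i.+2 * b i) * z i.+1 + b i * z i.+2.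
Proof.
move=> [_ _ hpsi hsg hph hw] x0 hi z; rewrite /z /=.
(* Where [sg] or [ph] is unconstrained, the truncated predecessor makes the other factor
   [x 0 = 0]. *)
have es : psi i * sg i * x i.-1 =
    (c i - ph i.+1 * (a i - sg i.+2 * b i)) * x i.-1.
  case: i hi {z} => [|[|i]] hi; [lia|by rewrite /= x0 !mulr0|].
  by rewrite hsg //; lia.
have ep : psi i * ph i * x i.-2 = e i * x i.-2.
  case: i hi {z es} => [|[|[|i]]] hi; [lia| | |].
  - by rewrite /= x0 !mulr0.
  - by rewrite /= x0 !mulr0.
  - by rewrite hph //; lia.
rewrite 2!mulrDr mulrN hw // mulrDr !mulrDr !mulrA es ep hpsi //.
ring.
Qed.

Lemma elimination_equiv (K : fieldType) (n : nat)
    (a b c d e y psi sg ph w x : nat -> K) :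
  elimination n a b c d e y psi sg ph w -> x 0%N = 0 ->
  (forall i, (n < i)%N -> x i = 0) ->
  (forall i, (0 < i <= n)%N ->
     e i * x i.-2 + c i * x i.-1 + d i * x i + a i * x i.+1 + b i * x i.+2
     = y i) <->
  (forall i, (0 < i <= n)%N -> x i = w i - sg i * x i.-1 - ph i * x i.-2).
Proof.
move=> E x0 xn.
pose z j := x j + sg j * x j.-1 + ph j * x j.-2 - w j.
have row i : (0 < i <= n)%N ->
    e i * x i.-2 + c i * x i.-1 + d i * x i + a i * x i.+1 + b i * x i.+2 - y i
    = psi i * z i + (a i - sg i.+2 * b i) * z i.+1 + b i * z i.+2.
  exact: elimination_row E x0.
have zout i : (n < i)%N -> z i = 0.
  by rewrite /z => hi; have [-> -> ->] := elim_out E hi; rewrite xn // !mul0r !addr0 subr0.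
have zE i : z i = 0 <-> x i = w i - sg i * x i.-1 - ph i * x i.-2.
  by rewrite /z; split=> h; [rewrite -[LHS]subr0 -h|rewrite {1}h]; ring.
split=> h i hi; last first.
  apply/eqP; rewrite -subr_eq0 row //.
  have z0 j : (0 < j)%N -> z j = 0.
    by move=> j0; have [jn|/zout//] := leqP j n; apply/zE/h; rewrite j0.
  by rewrite !z0 ?mulr0 ?addr0 //; lia.
apply/zE; move: i hi.
(* Back substitution in U z = 0: [k] bounds the distance to row [n], and [zout] starts it. *)
suff zk k i : (n <= i + k)%N -> (0 < i)%N -> z i = 0.
  by move=> i /andP[i0 _]; apply: (zk n) => //; lia.
elim: k i => [|k IH] i hk i0.
  have [hin|/zout//] := leqP i n; have hi : (0 < i <= n)%N by lia.
  move: (row i hi); rewrite h // subrr.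
  rewrite (zout i.+1) 1?(zout i.+2) ?mulr0 ?addr0; try lia.
  by move/esym/eqP; rewrite mulf_eq0 (negPf (elim_psi0 E hi)) => /eqP.
have [hin|/zout//] := leqP i n; have hi : (0 < i <= n)%N by lia.
move: (row i hi); rewrite h // subrr.
rewrite (IH i.+1) 1?(IH i.+2) ?mulr0 ?addr0; try lia.
by move/esym/eqP; rewrite mulf_eq0 (negPf (elim_psi0 E hi)) => /eqP.
Qed.

(** * Rows of P X as five-term sums *)

Lemma sum_ord_delta (K : nzRingType) (n : nat) (x : nat -> K) (k : nat) (f : K) :
  (forall j, (n < j)%N -> x j = 0) ->
  \sum_(j < n) (if j == k :> nat then f else 0) * x j.+1 = f * x k.+1.
Proof.
move=> xn; have [kn|nk] := ltnP k n; last first.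
  rewrite xn ?ltnS // mulr0 big1 // => j _.
  by case: eqP => [jk|_]; [have := ltn_ord j; lia|rewrite mul0r].
rewrite (bigD1 (Ordinal kn)) //= eqxx big1 ?addr0 // => j jk.
by rewrite ifN ?mul0r.
Qed.

Lemma pentadiag_mulmxE (K : fieldType) (n : nat) (a b c d e x : nat -> K)
    (i : 'I_n) (j : 'I_1) :
  x 0%N = 0 -> (forall j, (n < j)%N -> x j = 0) ->
  (pentadiag n a b c d e *m \col_(k < n) x k.+1) i j =
  e i.+1 * x i.-1 + c i.+1 * x i + d i.+1 * x i.+1 + a i.+1 * x i.+2
  + b i.+1 * x i.+3.
Proof.
move=> x0 xn; rewrite mxE.
(* The diagonal at distance [m.+1] below the main one; where it leaves the matrix, [i - m] truncates
   to 0 and [x 0 = 0]. *)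
have lower (m : nat) (f : K) :
    \sum_(k < n) (if i == (k + m.+1)%N :> nat then f else 0) * x k.+1
    = f * x (i - m)%N.
  have [im|mi] := ltnP m i.
    rewrite -[in RHS](@prednK (i - m)) ?subn_gt0 // -(sum_ord_delta _ f xn).
    by apply: eq_bigr => k _; congr (_ * _); case: eqP; case: eqP => //; lia.
  rewrite (_ : (i - m)%N = 0%N) ?x0 ?mulr0; last by lia.
  by apply: big1 => k _; case: eqP; [lia|rewrite mul0r].
have := lower 0 (c i.+1); have := lower 1 (e i.+1).
rewrite subn0 subn1 => <- <-.
rewrite -!(sum_ord_delta _ _ xn) -!big_split /=.
apply: eq_bigr => k _; rewrite !mxE -!mulrDl addn1 addn2; congr (_ * _).
do 5 case: eqP => ? /=; rewrite ?addr0 ?add0r //; lia.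
Qed.

(** * From stored values to elimination equations *)

Lemma ptransII_elimination (K : fieldType) (n : nat)
    (a b c d e y : nat -> K) :
  (4 <= n)%N ->
  (forall i : nat, (1 <= i <= n)%N ->
     exists2 v : K, ptransII_psi n a b c d e y i = Some v & v != 0) ->
  exists psi sg ph w x : nat -> K,
    [/\ elimination n a b c d e y psi sg ph w,
        x 0%N = 0, forall i, (n < i)%N -> x i = 0,
        forall i, (0 < i <= n)%N ->
          (run (ptransII_prog n a b c d e y)).1 X i = Some (x i)
      & forall i, (0 < i <= n)%N ->
          x i = w i - sg i * x i.-1 - ph i * x i.-2].
Proof.
rewrite /ptransII_psi => hn.
have := foldl_exec_satisfies (fun _ _ => None, 0%N)
          (ptransII_ranked a b c d e y hn).
rewrite -/(run _); set s := (run _).1; rewrite /ptransII_prog !satisfies_cat.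
move=> [[hYn [hSn [hPn [hWn _]]]]].
move=> [[hRm [hYm [hSm [hPm [hWm _]]]]]].
move=> [/satisfies_flatten hloop].
move=> [[hR2 [hY2 [hS2 [hR1 [hY1 [hW2 [hW1 _]]]]]]]].
move=> [[hX1 [hX2 _]]] /satisfies_map hX hpsi.
rewrite /= in hYn hSn hPn hWn hRm hYm hSm hPm hWm hR2 hY2 hS2 hR1 hY1 hW2 hW1 hX1 hX2.
pose val r i := if (0 < i <= n)%N then odflt 0 (s r i) else 0.
have valE r i v : (0 < i <= n)%N -> s r i = Some v -> val r i = v.
  by move=> hi hv; rewrite /val hi hv.
have out r i : (n < i)%N -> val r i = 0.
  by move=> hi; rewrite /val ifN //; lia.
pose rho i := a i - val Sigma i.+2 * b i.
(* The guards reflect that step (4) assigns neither [Sigma] at 1 nor [Phi] at 1 and 2. *)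
pose def i := [/\ s W i = Some (val W i),
  (1 < i)%N -> s Sigma i = Some (val Sigma i),
  (2 < i)%N -> s Phi i = Some (val Phi i)
  & [/\ val Psi i = d i - val Phi i.+2 * b i - val Sigma i.+1 * rho i,
     (1 < i)%N -> val Psi i * val Sigma i = c i - val Phi i.+1 * rho i,
     (2 < i)%N -> val Psi i * val Phi i = e i
   & val Psi i * val W i = y i - val W i.+2 * b i - val W i.+1 * rho i]].
have step i v : (0 < i <= n)%N -> s Psi i = Some v -> v != 0 ->
    v = d i - val Phi i.+2 * b i - val Sigma i.+1 * rho i ->
    ((1 < i)%N -> s Sigma i = Some ((c i - val Phi i.+1 * rho i) / v)) ->
    ((2 < i)%N -> s Phi i = Some (e i / v)) ->
    s W i = Some ((y i - val W i.+2 * b i - val W i.+1 * rho i) / v) ->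
    def i.
  move=> hi sv v0 vE sS sP sW.
  have divK f : v * (f / v) = f by rewrite mulrC divfK.
  rewrite /def (valE _ _ _ hi sv) (valE _ _ _ hi sW) sW divK.
  split=> // [h|h|]; [by rewrite sS // (valE _ _ _ hi (sS h))| |].
    by rewrite sP // (valE _ _ _ hi (sP h)).
  by split=> // h; [rewrite (valE _ _ _ hi (sS h))|rewrite (valE _ _ _ hi (sP h))].
have psiP i : (0 < i <= n)%N -> exists2 v : K, s Psi i = Some v & v != 0.
  exact: hpsi.
(* The zero values of [val] past [n] collapse the general formulas to those of step (1), and below
   to those of step (2). *)
have defn : def n.
  have hi : (0 < n <= n)%N by lia.
  have [v sv v0] := psiP n hi; apply: (step _ _ hi sv v0) => [|_|_|].
  all: rewrite /rho ?(out _ n.+1) ?(out _ n.+1) ?(out _ n.+2) ?(out _ n.+2) // ?mul0r ?subr0.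
  - by move: sv; rewrite hYn => -[].
  - by rewrite hSn sv (negPf v0).
  - by rewrite hPn sv (negPf v0).
  - by rewrite hWn sv (negPf v0).
have nS : n = n.-1.+1 by lia.
have defm : def n.-1.
  have hi : (0 < n.-1 <= n)%N by lia.
  have [dW dS dP _] := defn.
  have [v sv v0] := psiP _ hi; apply: (step _ _ hi sv v0) => [|_|_|].
  all: rewrite /rho -?nS ?(out _ n.+1) ?(out _ n.+1) // ?mul0r ?subr0.
  - by move: sv; rewrite hYm hRm dS /=; [case|lia].
  - by rewrite hSm sv hRm dP /= ?(negPf v0) //; lia.
  - by rewrite hPm sv /= (negPf v0).
  - by rewrite hWm sv hRm dW /= (negPf v0).
have defi i : (2 < i)%N -> def i.+1 -> def i.+2 -> (i < n.-1)%N -> def i.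
  move=> i2 [dW1 dS1 dP1 _] [dW2 dS2 dP2 _] im.
  have hi : (0 < i <= n)%N by lia.
  have := hloop i; rewrite mem_rev mem_iota.
  case=> [|hR [hY [hS [hP [hW _]]]]]; first lia.
  rewrite /= in hR hY hS hP hW.
  rewrite dS2 //= in hR.
  have [v sv v0] := psiP _ hi; apply: (step _ _ hi sv v0) => [|_|_|].
  - by move: sv; rewrite hY hR dP2 ?dS1 /=; [case|lia|lia].
  - by rewrite hS sv hR dP1 /= ?(negPf v0) //; lia.
  - by rewrite hP sv /= (negPf v0).
  - by rewrite hW sv hR dW1 dW2 /= (negPf v0).
have def3 i : (2 < i <= n)%N -> def i.
  (* Downward induction on the row, with two base cases because row [i] uses rows [i.+1] and
     [i.+2]. *)
  suff H k : (k < n - 2)%N -> def (n - k)%N.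
    by move=> hi; rewrite -(@subKn i n); [apply: H|]; lia.
  elim/ltn_ind: k => -[|[|k]] IH hk; first by rewrite subn0.
    by rewrite subn1.
  apply: defi; [lia| | |lia].
    have -> : (n - k.+2).+1 = (n - k.+1)%N by lia.
    by apply: IH; lia.
  have -> : (n - k.+2).+2 = (n - k)%N by lia.
  by apply: IH; lia.
have [dW3 dS3 dP3 _] : def 3 by apply: def3; lia.
have [dW4 dS4 dP4 _] : def 4 by apply: def3; lia.
have [v2 sv2 v20] := psiP 2%N (ltnW (ltnW hn)).
have [v1 sv1 v10] := psiP 1%N (ltnW (ltnW (ltnW hn))).
rewrite dS4 //= in hR2; rewrite dS3 //= in hR1.
have def2 : def 2%N.
  apply: (step _ _ _ sv2 v20) => [||_|//|]; first lia.
  - by move: sv2; rewrite hY2 hR2 dP4 ?dS3 //=; case.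
  - by rewrite hS2 sv2 hR2 dP3 //= (negPf v20).
  - by rewrite hW2 sv2 hR2 dW3 dW4 /= (negPf v20).
have [dW2 dS2 _ _] := def2.
have def1 : def 1%N.
  apply: (step _ _ _ sv1 v10) => [||//|//|]; first lia.
  - by move: sv1; rewrite hY1 hR1 dP3 ?dS2 //=; case.
  - by rewrite hW1 sv1 hR1 dW3 dW2 /= (negPf v10).
have defP i : (0 < i <= n)%N -> def i.
  by case: i => [|[|[|i]]] // hi; apply: def3; lia.
have [dW1 _ _ _] := def1.
have sX : forall i, (0 < i <= n)%N -> s X i = Some (val X i) /\
    val X i = val W i - val Sigma i * val X i.-1 - val Phi i * val X i.-2.
  have X0 : val X 0 = 0 by [].
  have E i v : (0 < i <= n)%N -> s X i = Some v ->
      v = val W i - val Sigma i * val X i.-1 - val Phi i * val X i.-2 ->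
      s X i = Some (val X i) /\
      val X i = val W i - val Sigma i * val X i.-1 - val Phi i * val X i.-2.
    by move=> hi hv <-; rewrite (valE _ _ _ hi hv).
  elim/ltn_ind => -[|[|[|i]]] IH hi //.
  - by apply: (E _ (val W 1)); rewrite ?hX1 //= X0 !mulr0 !subr0.
  - have [sX1 _] := IH 1%N isT (ltnW (ltnW (ltnW hn))).
    apply: (E _ (val W 2 - val Sigma 2 * val X 1)); rewrite // ?X0 ?mulr0 ?subr0 //.
    by rewrite hX2 dW2 dS2 // sX1.
  - have [sX1 _] := IH i.+1 ltac:(lia) ltac:(lia).
    have [sX2 _] := IH i.+2 ltac:(lia) ltac:(lia).
    apply: (E _ _ hi _ erefl).
    have := hX i.+3; rewrite mem_iota /= => -> ; last lia.
    have [-> -> // -> // _] := defP _ hi.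
    by rewrite sX1 sX2.
exists (val Psi), (val Sigma), (val Phi), (val W), (val X).
split=> // [||i hi|i hi]; [|exact: out|exact: (sX i hi).1|exact: (sX i hi).2].
split=> [i hi|i hi|i hi|i hi|i hi|i hi].
- by have [v sv v0] := psiP _ hi; rewrite (valE _ _ _ hi sv).
- by rewrite !out.
- by have [_ _ _ []] := defP _ hi.
- by have [_ _ _ [_ h _ _]] := defP i ltac:(lia); apply: h; lia.
- by have [_ _ _ [_ _ h _]] := defP i ltac:(lia); apply: h; lia.
- by have [_ _ _ []] := defP _ hi.
Qed.

(** * Validity, uniqueness and cost *)

Theorem mainTheorem2 (R : realType) (K : fieldType)
    (hK : K = R :> fieldType \/ K = R[i]%C :> fieldType)
    (n : nat) (hn : (4 <= n)%N)
    (a b c d e y : nat -> K) (P : 'M[K]_n) (Y : 'cV[K]_n)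
    (hP : P = pentadiag n a b c d e)
    (hY : Y = \col_(i < n) y i.+1)
    (hpsi : forall i : nat, (1 <= i <= n)%N ->
       exists2 v : K, ptransII_psi n a b c d e y i = Some v & v != 0) :
  (exists X : 'cV[K]_n,
     [/\ ptransII n a b c d e y = Some X,
         P *m X = Y
       & forall X' : 'cV[K]_n, P *m X' = Y -> X' = X]) /\
  ptransII_cost n a b c d e y = (19 * n - 29)%N.
Proof.
split; last exact: ptransII_cost_eq.
have [psi [sg [ph [w [x [E x0 xn sX xE]]]]]] := ptransII_elimination hn hpsi.
pose V : 'cV[K]_n := \col_(i < n) x i.+1.
have PV : P *m V = Y.
  apply/matrixP => i j; rewrite hP hY pentadiag_mulmxE // [RHS]mxE.
  by apply: (elimination_equiv E x0 xn).2 xE i.+1 _; rewrite ltn_ord.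
have uniqV (V' : 'cV[K]_n) : P *m V' = Y -> V' = V.
  move=> PV'.
  (* The entries of [V'], shifted to 1-based indices and extended by zero on both sides. *)
  pose x' k := if k is j.+1 then oapp (fun i => V' i 0) 0 (insub j) else 0.
  have x'E (i : 'I_n) : x' i.+1 = V' i 0 by rewrite /x' valK.
  have x'n i : (n < i)%N -> x' i = 0.
    by case: i => // i hi; rewrite /x' insubN // -leqNgt.
  have V'E : V' = \col_(i < n) x' i.+1.
    by apply/colP => i; rewrite mxE x'E.
  have x'W : forall i, (0 < i <= n)%N ->
      x' i = w i - sg i * x' i.-1 - ph i * x' i.-2.
    apply: (elimination_equiv E _ x'n).1 => // -[//|i] hi.
    have := congr1 (fun M : 'cV[K]_n => M (Ordinal hi) 0) PV'.
    by rewrite V'E hP hY pentadiag_mulmxE // mxE.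
  have xx' : forall k, (k <= n)%N -> x' k = x k.
    elim/ltn_ind => -[|k] IH hk; first by rewrite x0.
    rewrite x'W // xE //= !IH //; lia.
  by apply/colP => i; rewrite mxE -x'E xx'.
exists V; split=> //.
(* A kernel vector of a singular P would contradict uniqueness. *)
have det0 : \det (pentadiag n a b c d e) != 0.
  rewrite -hP -det_tr; apply/det0P => -[u u0 uP].
  have Pu : P *m u^T = 0 by rewrite -[P]trmxK -trmx_mul uP trmx0.
  have /uniqV/eqP : P *m (V + u^T) = Y by rewrite mulmxDr PV Pu addr0.
  rewrite -subr_eq0 addrAC subrr add0r => /eqP/(congr1 trmx).
  by rewrite trmxK trmx0 => /eqP; rewrite (negPf u0).
rewrite /ptransII (negPf det0) ifT.
  by congr Some; apply/colP => i; rewrite !mxE sX ?ltn_ord.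
by apply/forallP => i; rewrite sX ?ltn_ord.
Qed.
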